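(* There exists an ultrafilter $\mathcal{U}\subseteq 2^\omega$ on $\omega$ that is not completely Baire.
   Context: Every subset of $\omega$ is identified with its characteristic function, so an ultrafilter on $\omega$ is regarded as a subset of the Cantor set $2^\omega$ and carries the subspace topology. A (separable metrizable) space $X$ is completely Baire if every closed subspace of $X$ is a Baire space. *)

(* Defs.v *)
From HB Require Import structures.
From mathcomp Require Import all_boot all_order all_algebra.
From mathcomp Require Import all_classical all_reals all_analysis.

Set Implicit Arguments.
Unset Strict Implicit.
Unset Printing Implicit Defensive.

Local Open Scope classical_set_scope.

Definition charfun (A : set nat) : cantor_space := fun n => n \in A.

(* [set_type A] carries the initial topology of the inclusion, whereas
   [subspace A] would keep the points outside [A] as isolated points. *)
Definition cantor_subspace (U : set_system nat) : topologicalType :=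
  set_type (charfun @` U).

Definition baire_space (X : topologicalType) : Prop :=
  forall F : nat -> set X, (forall n, open (F n) /\ dense (F n)) ->
    dense (\bigcap_n F n).

Definition completely_baire (X : topologicalType) : Prop :=
  forall C : set X, closed C -> baire_space (set_type C).

(* Main.v *)
Require Import Defs.
From mathcomp Require Import all_boot all_order all_algebra.
From mathcomp Require Import all_classical all_reals all_analysis.

(** The idea is to build an ultrafilter that contains a copy of the rationals
    as a relatively closed subset: a nonempty countable space without isolated
    points is the union of countably many closed sets with empty interior, so
    it is not Baire ([countable_crowded_not_baire]).

    The copy of the rationals comes from a compact independent family.  Take
    the finite lists [t] of finite binary words as a countable index set, and
    attach to every point [x] of the Cantor space the set of those [t] that
    contain a prefix of [x].  These sets are independent: given finitely many
    points and a subset of them, choose a length at which all their prefixes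
    are distinct, and let [t] collect the prefixes of the chosen points
    ([branch_independent]).  Hence for every set [Q] of points some ultrafilter
    [U] contains the sets attached to the points of [Q] and the complements of
    all the others ([branch_ultrafilter]).

    The map [branch] that sends a point to its set is continuous and injective
    on a compact space, so its range is closed, and it meets [U] exactly in the
    image of [Q].  With [Q] the sequences that are eventually zero, a countable
    set without isolated points, this intersection is a closed subspace of [U]
    that is not Baire. *)

Set Implicit Arguments.
Unset Strict Implicit.
Unset Printing Implicit Defensive.

Local Open Scope classical_set_scope.

(** The complements of the points are countably many dense open sets with empty
    intersection.  The enumeration [e] also makes the space nonempty. *)
Lemma countable_crowded_not_baire (X : topologicalType) (e : nat -> X) :
  accessible_space X -> (forall x, exists n, e n = x) ->
  (forall x : X, ~ open [set x]) -> ~ baire_space X.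
Proof.
move=> T1X e_surj crowded baireX.
have dense_coset n : open (~` [set e n]) /\ dense (~` [set e n]).
  split; first exact/closed_openC/accessible_closed_set1.
  move=> O [x Ox] oO; apply: contrapT => /set0P/negP/negPn/eqP OI0.
  have OE y : O y -> y = e n.
    by move=> Oy; apply: contrapT => yNe; rewrite -[False]/(set0 y) -OI0.
  apply: (crowded x); suff <- : O = [set x] by [].
  by apply/seteqP; split=> y /= => [/OE ->|->//]; rewrite (OE _ Ox).
have [|//|y [_ yNe]] := baireX _ dense_coset [set: X]; first by exists (e 0).
- exact: openT.
- by have [n en] := e_surj y; apply: (yNe n).
Qed.

Lemma near_all_seq (T : Type) (I : eqType) (F : set_system T) (s : seq I)
    (P : I -> T -> Prop) : Filter F ->
  (forall i, \forall x \near F, P i x) ->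
  \forall x \near F, forall i, i \in s -> P i x.
Proof.
move=> FF nearP; elim: s => [|j s IHs]; first exact: nearW.
near=> x => i; rewrite inE => /predU1P[->|]; first by near: x.
by move: i; near: x.
Unshelve. all: by end_near. Qed.

Lemma cvg_cantor (F : set_system cantor_space) (x : cantor_space) :
  Filter F -> (forall n, F [set y | y n = x n]) -> F --> x.
Proof.
move=> FF nearF; apply/cvg_sup => n U [_ [[B _ <-] Bx sBU]].
by apply: filterS (nearF n) => y yn; apply: sBU; rewrite /= yn.
Qed.

Lemma near_coord (x : cantor_space) n : nbhs x [set y : cantor_space | y n = x n].
Proof.
have /= := @proj_continuous nat (fun=> bool) n x [set x n].
by apply; apply: open_nbhs_nbhs; split=> //; exact: discrete_open.
Qed.

Lemma near_mkseq (x : cantor_space) n :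
  nbhs x [set y : cantor_space | mkseq y n = mkseq x n].
Proof.
have := near_all_seq (iota 0 n) (nbhs_filter x) (near_coord x).
by apply: filterS => y yx; apply/eq_in_map.
Qed.

Lemma near_mkseq_inj (x y : cantor_space) :
  \forall n \near \oo, mkseq x n = mkseq y n -> x = y.
Proof.
have [->|/eqP xNy] := eqVneq x y; first exact: nearW.
have [i xNyi] : exists i, x i <> y i.
  by apply/existsNP => xy; apply/xNy/funext.
exists i.+1 => //= n /= ltin /(congr1 (nth false ^~ i)).
by rewrite !nth_mkseq.
Qed.

(** The set attached to [x], as a point of the Cantor space: the codes of the
    finite lists [t] of words such that some word of [t] is a prefix of [x]. *)
Definition branch (x : cantor_space) : cantor_space := fun m =>
  if unpickle m is Some t then
    has (fun s : seq bool => s == mkseq x (size s)) t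
  else false.

(** The list that consists of the prefixes of the points in [Q], all of a length
    that separates the points of [xs], contains no prefix of the other points,
    since all its words have that length. *)
Lemma branch_independent (Q : set cantor_space) (xs : seq cantor_space) :
  exists m, forall x, x \in xs -> branch x m = (x \in Q).
Proof.
have [n sepn] : exists n, forall x, x \in xs -> forall y, y \in xs ->
    mkseq x n = mkseq y n -> x = y.
  have near2 x := near_all_seq xs eventually_filter (near_mkseq_inj x).
  exact: filter_ex (near_all_seq xs eventually_filter near2).
exists (pickle [seq mkseq x n | x <- xs & x \in Q]) => x xs_x.
rewrite /branch pickleK; apply/hasP/idP => [[_ /mapP[y + ->]]|Qx].
  rewrite mem_filter size_mkseq => /andP[Qy xs_y] /eqP.
  by move=> /sepn <-.
exists (mkseq x n); last by rewrite size_mkseq.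
by apply: map_f; rewrite mem_filter Qx.
Qed.

Lemma branch_inj : injective branch.
Proof.
move=> x y bxy; have [m mP] := branch_independent [set x] [:: x; y].
have : y \in [set x] by rewrite -mP ?inE ?eqxx ?orbT// -bxy mP ?mem_head ?inE.
by rewrite inE => ->.
Qed.

(** A given list only inspects finitely many coordinates of the point. *)
Lemma branch_continuous : continuous branch.
Proof.
move=> x; apply: cvg_cantor => m.
change (nbhs x [set y : cantor_space | branch y m = branch x m]).
rewrite /branch; case: (unpickle m) => [t|]; last exact: filterE.
have := near_all_seq t (nbhs_filter x) (fun s => near_mkseq x (size s)).
by apply: filterS => y yx; apply: eq_in_has => s /yx ->.
Qed.

(** By independence, the constraints imposed by [Q] have the finite intersection
    property, so they generate a proper filter. *)
Lemma branch_ultrafilter (Q : set cantor_space) :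
  exists2 U : set_system nat, UltraFilter U &
    forall x, U [set m | branch x m] <-> Q x.
Proof.
pose F : set_system nat := [set B | exists xs : seq cantor_space,
  forall m, (forall x, x \in xs -> branch x m = (x \in Q)) -> B m].
have FF : ProperFilter F.
  split; first by move=> [xs xsP]; have [m /xsP] := branch_independent Q xs.
  split; first by exists [::].
    move=> A B [xs xsP] [ys ysP]; exists (xs ++ ys) => m mP; split.
      by apply: xsP => x x_xs; apply: mP; rewrite mem_cat x_xs.
    by apply: ysP => x x_ys; apply: mP; rewrite mem_cat x_ys orbT.
  by move=> A B sAB [xs xsP]; exists xs => m /xsP /sAB.
have [U [UU sFU]] := ultraFilterLemma FF; exists U => // x.
have UxP : U [set m | branch x m = (x \in Q)].
  by apply: sFU; exists [:: x] => m; apply; exact: mem_head.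
split=> [Ux|Qx]; last by apply: filterS UxP => m /= ->; apply/mem_set.
have [m [/= bm]] := filter_ex (filterI UxP Ux).
by rewrite bm => /set_mem.
Qed.

Definition eventually_zero (s : seq bool) : cantor_space := nth false s.

(** Switching on one coordinate beyond the end of [s] gives another eventually
    zero sequence, as close to the first one as desired. *)
Lemma eventually_zero_crowded (s : seq bool) (V : set cantor_space) :
  nbhs (eventually_zero s) V ->
  exists2 r, V (eventually_zero r) & eventually_zero r <> eventually_zero s.
Proof.
pose q n := eventually_zero (set_nth false s n true).
have q_cvg : q @ \oo --> eventually_zero s.
  apply: cvg_cantor => i; exists i.+1 => // n /= ltin.
  by rewrite /q /eventually_zero nth_set_nth /= ltn_eqF.
move=> /q_cvg[N _ NV]; pose n := maxn N (size s).
exists (set_nth false s n true); first exact/NV/leq_maxl.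
move/(congr1 (fun x : cantor_space => x n)).
by rewrite /eventually_zero nth_set_nth /= eqxx nth_default // leq_maxr.
Qed.

Lemma charfun_set (x : cantor_space) : charfun [set m | x m] = x.
Proof. by apply/funext => m; apply/asboolP/idP. Qed.

Lemma charfunK (A : set nat) : [set m | charfun A m] = A.
Proof. by apply/seteqP; split=> m /=; rewrite inE. Qed.

Lemma charfun_imageE (U : set_system nat) (x : cantor_space) :
  (charfun @` U) x <-> U [set m | x m].
Proof.
split=> [[B UB <-]|Ux]; first by rewrite charfunK.
by exists [set m | x m] => //; exact: charfun_set.
Qed.

Theorem corollary9 :
  exists U : set_system nat,
    UltraFilter U /\ ~ completely_baire (cantor_subspace U).
Proof.
have [U UU UQ] := branch_ultrafilter (range eventually_zero).
exists U; split=> // cbU.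
pose C : set (cantor_subspace U) := set_val @^-1` range branch.
have Cclosed : closed C.
  apply: closed_comp => [? _|]; first exact: initial_continuous.
  apply: compact_closed; first exact: cantor_space_hausdorff.
  apply: continuous_compact; last exact: cantor_space_compact.
  exact/continuous_subspaceT/branch_continuous.
have pointP s : exists c : set_type C, val (val c) = branch (eventually_zero s).
  have Ub : (charfun @` U) (branch (eventually_zero s)).
    by apply/charfun_imageE/UQ; exists s.
  pose u : cantor_subspace U :=
    exist (fun x => x \in charfun @` U) _ (mem_set Ub).
  have Cu : C u by exists (eventually_zero s).
  by exists (exist (fun v => v \in C) u (mem_set Cu)).
have [p pE] := choice pointP.
have val2_inj : injective (fun c : set_type C => val (val c)).
  by move=> c d /val_inj/val_inj.
(* The sets attached to the other points are left out of [U], so only the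
   eventually zero points contribute to [C]. *)
have p_surj c : exists s, p s = c.
  have /set_mem[x _ bx] := valP c; have /set_mem := valP (val c).
  rewrite -[\val _]bx => /charfun_imageE/UQ[s _ sx].
  by exists s; apply: val2_inj; rewrite /= pE sx.
pose e n := p (odflt [::] (unpickle n)).
apply: (@countable_crowded_not_baire (set_type C) e); last exact: cbU.
- move=> c d cNd.
  have [|V [oV Vc Vd]] := hausdorff_accessible cantor_space_hausdorff
    (x := val (val c)) (y := val (val d)).
    by apply: contra_neq cNd => /val2_inj.
  exists [set c | V (val (val c))]; split.
  + by exists (set_val @^-1` V) => //; exists V.
  + exact/mem_set/set_mem.
  + by apply/mem_set => /=; exact: (set_mem Vd).
- by move=> c; have [s <-] := p_surj c; exists (pickle s); rewrite /e pickleK.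
- move=> c; have [s <-] := p_surj c => -[_ [V oV <-] cV].
  have inV r : V (branch (eventually_zero r)) <-> p r = p s.
    by rewrite -pE -[p r = p s]/([set p s] (p r)) -cV.
  have nbhsV : nbhs (branch (eventually_zero s)) V.
    by apply: open_nbhs_nbhs; split=> //; exact/inV.
  have [r /inV prs] := eventually_zero_crowded (branch_continuous nbhsV).
  by apply; apply: branch_inj; rewrite -!pE prs.
Qed.
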